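(* Consider the following statements: (i) $(\mu_\alpha)$ is $X_0$-exponentially tight with respect to $(t_\alpha)$; (ii) $(\mu_\alpha)$ is exponentially tight with respect to $(t_\alpha)$ and $l_0(x)=+\infty$ for all $x\in X\setminus X_0$; (iii) for all $F\in\mathcal{F}$, for all open covers $\{G_i:i\in I\}$ of $F\cap X_0$ and for all $\varepsilon>0$, there exists a finite set $\{G_{i_1},\dots,G_{i_N}\}\subset\{G_i:i\in I\}$ such that $$\limsup\mu_\alpha^{t_\alpha}(F)-\limsup\mu_\alpha^{t_\alpha}\Big(\bigcup_{1\le j\le N}\overline{G_{i_j}}\Big)<\varepsilon.$$ The following conclusions hold. (a) (i) implies (iii); (ii) implies (iii); and (i) implies (ii) when $\mathcal{K}\subset\mathcal{F}$. (b) If (iii) holds and $\Lambda(h)$ exists for every $h$ in the negative part $\mathcal{T}_-$ of an approximating class $\mathcal{T}$, then $(\mu_\alpha)$ satisfies a large deviation principle with powers $(t_\alpha)$ and rate function $l_{\mathcal{T}}$. Moreover, $l_{\mathcal{T}}=l_{\mathcal{T}_-}$ and $$\forall x\in X_0,\quad l_{\mathcal{T}}(x)=\inf_{t>0}\ \sup_{\{h\in\mathcal{T}_-:h(x)\ge-t\}}\{-\Lambda(h)\}=\inf_{t>0}\ \sup_{\{h\in\mathcal{T}:h(x)\ge-t\}}\Big\{\lim_{M\to+\infty}-\underline{\Lambda}(h_M)\Big\}.$$ If only one rate function can govern the large deviations, then $$\forall x\in X,\quad l_{\mathcal{T}}(x)=\sup_{G\in\mathcal{G},\,G\ni x}\ \inf_{y\in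 G\cap X_0}l_{\mathcal{T}}(y).$$
   Context: $X$ is a topological space, not reduced to one point, in which compact sets are Borel sets; no separation axiom is assumed. $\mathcal{F},\mathcal{G},\mathcal{K}$ denote the sets of closed, open, compact subsets of $X$; $\mathcal{C}_b(X)$ is the set of real-valued bounded continuous functions. $(\mu_\alpha)$ is a net of Borel probability measures on $X$ and $(t_\alpha)$ a net (same index set) in $]0,+\infty[$ converging to $0$. Write $\mu_\alpha^{t_\alpha}(A)=(\mu_\alpha(A))^{t_\alpha}$ for Borel $A$; for Borel measurable $h:X\to[-\infty,+\infty[$ and a Borel set $A$, $\mu_\alpha^{t_\alpha}(e^{h/t_\alpha}1_A)=\big(\int_A e^{h(x)/t_\alpha}\mu_\alpha(dx)\big)^{t_\alpha}$, and $\mu_\alpha^{t_\alpha}(e^{h/t_\alpha})$ is the case $A=X$. Put $\overline\Lambda(h)=\log\limsup\mu_\alpha^{t_\alpha}(e^{h/t_\alpha})$, $\underline\Lambda(h)=\log\liminf\mu_\alpha^{t_\alpha}(e^{h/t_\alpha})$, and $\Lambda(h)=\log\lim\mu_\alpha^{t_\alpha}(e^{h/t_\alpha})$ when this limit exists (existence of $\Lambda(h)$ is in $[-\infty,+\infty]$). Conventions: $e^{-\infty}=0$, $\log0=-\infty$, $\inf\emptyset=+\infty$. Large deviation principle with powers $(t_\alpha)$: for a function $l:X\to[0,+\infty]$, $\limsup\mu_\alpha^{t_\alpha}(F)\le\sup_{x\in F}e^{-l(x)}$ for all $F\in\mathcal{F}$ and $\sup_{x\in G}e^{-l(x)}\le\liminf\mu_\alpha^{t_\alpha}(G)$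 for all $G\in\mathcal{G}$; the lower regularization of $l$ (the greatest lower semi-continuous function $\le l$) is then called a rate function. $l_0(x)=-\log\inf\{\limsup\mu_\alpha^{t_\alpha}(G):G\in\mathcal{G},G\ni x\}$ for $x\in X$. $X_0$ is the set of $x\in X$ such that for each $G\in\mathcal{G}$ containing $x$, each real $s>0$ and each real $t>0$ there is $h\in\mathcal{C}_b(X)$ with $$e^{-t}1_{\{x\}}\le e^h\le1_G\vee e^{-s}.\qquad(\star)$$ A class $\mathcal{T}$ of $[-\infty,+\infty[$-valued continuous functions on $X$ is approximating if for each $x\in X_0$, each $G\in\mathcal{G}$ containing $x$, each $s>0$ and each $t>0$, $\mathcal{T}$ contains some $h$ satisfying $(\star)$. Its negative part is $\mathcal{T}_-=\{h\in\mathcal{T}:h\le0\}$ (again an approximating class). $(\mu_\alpha)$ is exponentially tight (resp. $X_0$-exponentially tight) with respect to $(t_\alpha)$ if for each $\varepsilon>0$ there is a compact $K\subset X$ (resp. a compact $K\subset X_0$) with $\limsup\mu_\alpha^{t_\alpha}(X\setminus K)<\varepsilon$. For an approximating class $\mathcal{T}$, $\mathcal{T}^T$ is the set of $h\in\mathcal{T}$ satisfying the tail condition $\lim_{M\to\infty}\limsup\mu_\alpha^{t_\alpha}(e^{h/t_\alpha}1_{\{e^h\ge M\}})=0$; for $G\in\mathcal{G}$ and $s\in]0,+\infty[$, $\mathcal{T}_{G,s}=\bigcup_{x\in G\cap X_0,\,t>0}\{h\in\mathcal{T}:e^h\le1_G\vee e^{-s},\ h(x)\ge-t\}$; and $$l_{\mathcal{T}}(x)=\begin{cases}\inf_{t>0}\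 \sup_{\{h\in\mathcal{T}^T:h(x)\ge-t\}}\{-\overline\Lambda(h)\}&\text{if }x\in X_0,\\ \sup_{G\in\mathcal{G},\,G\ni x}\ \sup_{0<s<\infty}\ \inf_{h\in\mathcal{T}_{G,s}}\{-\overline\Lambda(h)\}&\text{if }x\in X\setminus X_0.\end{cases}$$ For $h\in\mathcal{T}$ and real $M$, $h_M=h1_{\{h<M\}}-\infty1_{\{h\ge M\}}$ (i.e. $h_M=h$ on $\{h<M\}$ and $-\infty$ elsewhere). *)

(* Defs.v *)
From HB Require Import structures.
From mathcomp Require Import all_boot all_order all_algebra.
From mathcomp Require Import all_classical all_reals all_analysis.
Import Order.TTheory GRing.Theory Num.Theory.
Import numFieldNormedType.Exports.

Set Implicit Arguments.
Unset Strict Implicit.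
Unset Printing Implicit Defensive.

Local Open Scope classical_set_scope.
Local Open Scope ring_scope.
Local Open Scope ereal_scope.

(* The pointed structure is required of every measurable type; it is harmless
   here, since a space that carries a probability measure is nonempty. *)

Notation borel X := (g_sigma_algebraType (@open X)).

Record directed (I : Type) (le : I -> I -> Prop) : Prop := Directed {
  directed_inhabited : inhabited I ;
  directed_refl : forall a, le a a ;
  directed_trans : forall a b c, le a b -> le b c -> le a c ;
  directed_ub : forall a b, exists c, le a c /\ le b c }.

(* A net converges when it converges along the filter of its tails. *)
Definition tails (I : Type) (le : I -> I -> Prop) : set_system I :=
  [set S | exists a, forall b, le a b -> S b].

(* The library's limf_esup and limf_einf only apply to functions on a
   filteredType, which an arbitrary directed set is not. *)
Definition net_limsup (R : realType) (I : Type) (le : I -> I -> Prop)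
    (u : I -> \bar R) : \bar R :=
  ereal_inf [set ereal_sup (u @` le a) | a in setT].
Definition net_liminf (R : realType) (I : Type) (le : I -> I -> Prop)
    (u : I -> \bar R) : \bar R :=
  ereal_sup [set ereal_inf (u @` le a) | a in setT].

(* Supremum in [0, +oo], where the supremum of the empty set is 0
   (ereal_sup set0 is -oo). *)
Definition sup_ge0 (R : realType) (A : set (\bar R)) : \bar R :=
  ereal_sup (A `|` [set 0]).

Section Functions.
Context (R : realType) (X : ptopologicalType).
Implicit Types (h l J : X -> \bar R) (G : set X) (T : set (X -> \bar R)).

Definition below_bump G (s : R) h : Prop :=
  forall y, expeR (h y) <= (Num.max (\1_G y) (expR (- s)))%:E.

(* e^(-r) 1_{x} <= e^h <= 1_G \/ e^(-s) *)
Definition bump (x : X) G (s r : R) h : Prop :=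
  (forall y, (expR (- r) * \1_[set x] y)%:E <= expeR (h y)) /\
  below_bump G s h.

Definition X0 : set X := [set x | forall (G : set X) (s r : R),
  open G -> G x -> (0 < s)%R -> (0 < r)%R ->
  exists f : X -> R,
    [/\ continuous f, bounded_fun f & bump x G s r (EFin \o f)]].

Definition approximating T : Prop :=
  (forall h, T h -> continuous h /\ (forall y, h y < +oo)) /\
  (forall (x : X) (G : set X) (s r : R),
     X0 x -> open G -> G x -> (0 < s)%R -> (0 < r)%R ->
     exists2 h, T h & bump x G s r h).

Definition negative_part T : set (X -> \bar R) :=
  [set h | T h /\ forall y, h y <= 0].

Definition truncation h (M : R) : X -> \bar R :=
  fun y => if h y < M%:E then h y else -oo.

Definition is_lower_regularization l J : Prop :=
  [/\ lower_semicontinuous J, (forall x, J x <= l x) &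
      forall J', lower_semicontinuous J' -> (forall x, J' x <= l x) ->
        forall x, J' x <= J x].

End Functions.
Arguments X0 : clear implicits.

Section LargeDeviations.
Context (R : realType) (X : ptopologicalType).
Context (I : Type) (le : I -> I -> Prop).
Context (mu : I -> probability (borel X) R) (t : I -> R).
Implicit Types (h l J : X -> \bar R) (A : set X) (T : set (X -> \bar R)).

Let limsup (u : I -> \bar R) : \bar R := net_limsup le u.
Let liminf (u : I -> \bar R) : \bar R := net_liminf le u.

Definition mu_pow A (a : I) : \bar R := poweR (mu a A) (t a).

Definition exp_pow_on A h (a : I) : \bar R :=
  poweR (\int[mu a]_(x in A) expeR ((t a)^-1%:E * h x)) (t a).

Definition exp_pow h (a : I) : \bar R := exp_pow_on setT h a.

Definition Lambda_sup h : \bar R := lne (limsup (exp_pow h)).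
Definition Lambda_inf h : \bar R := lne (liminf (exp_pow h)).
Definition Lambda_exists h : Prop := cvg (exp_pow h @ tails le).
(* meaningful only under Lambda_exists h *)
Definition Lambda h : \bar R := lne (lim (exp_pow h @ tails le)).

Definition ldp_bounds l : Prop :=
  [/\ forall x, 0 <= l x,
      forall F, closed F ->
        limsup (mu_pow F) <= sup_ge0 [set expeR (- l x) | x in F] &
      forall G, open G ->
        sup_ge0 [set expeR (- l x) | x in G] <= liminf (mu_pow G)].

(* A rate function is the lower regularization of a function for which the
   bounds hold. *)
Definition ldp_rate_function J : Prop :=
  exists2 l, ldp_bounds l & is_lower_regularization l J.

Definition l0 (x : X) : \bar R :=
  - lne (ereal_inf [set limsup (mu_pow G) | G in [set G | open G /\ G x]]).

Definition exponentially_tight : Prop :=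
  forall e : R, (0 < e)%R -> exists K : set X,
    compact K /\ limsup (mu_pow (~` K)) < e%:E.

Definition X0_exponentially_tight : Prop :=
  forall e : R, (0 < e)%R -> exists K : set X,
    [/\ compact K, K `<=` X0 R X & limsup (mu_pow (~` K)) < e%:E].

(* The open cover is given as the set C = {G_i : i in I}.  The finite subset D
   may be empty, as it has to be when C is. *)
Definition finite_cover_condition : Prop :=
  forall (F : set X) (C : set (set X)) (e : R),
    closed F -> (forall G, C G -> open G) ->
    F `&` X0 R X `<=` \bigcup_(G in C) G -> (0 < e)%R ->
    exists D : set (set X), [/\ finite_set D, D `<=` C &
      limsup (mu_pow F) - limsup (mu_pow (\bigcup_(G in D) closure G)) < e%:E].

Definition tail_condition h : Prop :=
  limsup (exp_pow_on [set x | M%:E <= expeR (h x)] h) @[M --> +oo%R] --> 0.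

Definition tail_part T : set (X -> \bar R) :=
  [set h | T h /\ tail_condition h].

Definition T_Gs T (G : set X) (s : R) : set (X -> \bar R) :=
  [set h | exists (x : X) (r : R), [/\ G x, X0 R X x, (0 < r)%R, T h &
             below_bump G s h /\ (- r)%:E <= h x]].

Definition l_in T (x : X) : \bar R :=
  ereal_inf [set ereal_sup [set - Lambda_sup h |
                              h in [set h | tail_part T h /\ (- r)%:E <= h x]]
            | r in [set r : R | (0 < r)%R]].

Definition l_out T (x : X) : \bar R :=
  ereal_sup [set ereal_sup [set ereal_inf [set - Lambda_sup h | h in T_Gs T G s]
                           | s in [set s : R | (0 < s)%R]]
            | G in [set G : set X | open G /\ G x]].

Definition l_class T (x : X) : \bar R :=
  if x \in X0 R X then l_in T x else l_out T x.

End LargeDeviations.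

(* Main.v *)
Require Import Defs.
From HB Require Import structures.
From mathcomp Require Import all_boot all_order all_algebra finmap.
From mathcomp Require Import all_classical all_reals all_analysis.
From mathcomp Require Import measurable_realfun.
Import Order.TTheory GRing.Theory Num.Theory.
Import numFieldNormedType.Exports.
Set Implicit Arguments.
Unset Strict Implicit.
Unset Printing Implicit Defensive.
Local Open Scope classical_set_scope.
Local Open Scope ring_scope.
Local Open Scope ereal_scope.

(* Since (a + b)^t <= 2^t max(a^t, b^t) and 2^(t_alpha) -> 1, the set function
   limsup mu^t is maxitive on finite unions; this gives (a).  For (b), a bump
   function h at x inside G squeezes exp(Lambda h) between limsup mu^t of a
   small neighbourhood of x and max(limsup mu^t(G), e^(-s)).  Hence both branches of
   the definition of l_T, as well as the two other formulas, agree with l_0 on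
   X_0, and the second branch is lower semicontinuous and equals l_T on all of
   X; where Lambda exists it also gives the lower bound.  The upper bound holds
   with the supremum over F /\ X_0: bump functions separate a point of X_0 from
   closed sets, so (iii) applies to neighbourhoods whose closures have small
   measure.  The bounds therefore also hold for the function equal to l_T on X_0
   and to +oo elsewhere, whose lower regularization is the last formula. *)

(** * Comparison of extended reals by testing against real numbers *)

Lemma lee_of_lt_fin (R : realType) (y z : \bar R) :
  (forall a : R, a%:E < y -> a%:E <= z) -> y <= z.
Proof.
case: y => [r| |] yz; last by rewrite leNye.
  by apply/lee_subgt0Pr => e e0; apply: yz; rewrite lte_fin ltrBlDr ltrDl.
by rewrite (_ : z = +oo)//; apply: eq_infty => r; exact: yz (ltry r).
Qed.

Lemma lee_of_gt_fin (R : realType) (y z : \bar R) :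
  (forall a : R, y < a%:E -> z <= a%:E) -> z <= y.
Proof.
move=> yz; rewrite -leeN2; apply: lee_of_lt_fin => a.
by rewrite lteNr leeNr -EFinN; exact: yz.
Qed.

(** * Limits superior and inferior along a directed set *)

Section NetLimits.
Context (R : realType) (I : Type) (le : I -> I -> Prop).
Hypothesis le_directed : directed le.
Implicit Types u v : I -> \bar R.

Lemma tails_proper_filter : ProperFilter (tails le).
Proof.
case: le_directed => -[a0] le_refl le_trans le_ub; split.
  by case=> a /(_ a (le_refl a)).
split; first by exists a0.
- move=> P Q [a Pa] [b Qb]; have [c [ac bc]] := le_ub a b.
  exists c => d cd; split; [exact/Pa/(le_trans _ _ _ ac)|].
  exact/Qb/(le_trans _ _ _ bc).
- by move=> P Q PQ [a Pa]; exists a => b /Pa/PQ.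
Qed.
#[local] Existing Instance tails_proper_filter.

Lemma net_limsup_le u y :
  (\forall a \near tails le, u a <= y) -> net_limsup le u <= y.
Proof.
move=> [a uy]; apply: ge_ereal_inf.
exists (ereal_sup (u @` le a)); first by exists a.
by apply/ereal_supP => _ [b ab <-]; exact: uy.
Qed.

Lemma net_liminf_ge u y :
  (\forall a \near tails le, y <= u a) -> y <= net_liminf le u.
Proof.
move=> [a uy]; apply: le_ereal_sup_tmp.
exists (ereal_inf (u @` le a)); first by exists a.
by apply/ereal_infP => _ [b ab <-]; exact: uy.
Qed.

Lemma net_liminf_le_limsup u : net_liminf le u <= net_limsup le u.
Proof.
apply/ereal_supP => _ [a _ <-]; apply/ereal_infP => _ [b _ <-].
have [c [ac bc]] := directed_ub le_directed a b.
apply: (@le_trans _ _ (u c)).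
  by apply: ereal_inf_lbound; exists c.
by apply: ereal_sup_ubound; exists c.
Qed.

Lemma net_limsup_le_addgt0 u v :
  (forall e : R, (0 < e)%R -> \forall a \near tails le, v a <= u a + e%:E) ->
  net_limsup le v <= net_limsup le u.
Proof.
move=> uv; apply/lee_addgt0Pr => e /uv[a0 vu]; rewrite -leeBlDr//.
apply/ereal_infP => _ [a _ <-]; rewrite leeBlDr//.
have [c [a0c ac]] := directed_ub le_directed a0 a.
apply: net_limsup_le; exists c => b cb.
apply: (le_trans (vu b (directed_trans le_directed a0c cb))).
rewrite leeD2r//; apply: ereal_sup_ubound; exists b => //.
exact: (directed_trans le_directed ac cb).
Qed.

Lemma net_liminf_le_addgt0 u v :
  (forall e : R, (0 < e)%R -> \forall a \near tails le, v a <= u a + e%:E) ->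
  net_liminf le v <= net_liminf le u.
Proof.
move=> uv; apply/lee_addgt0Pr => e /uv[a0 vu].
apply/ereal_supP => _ [a _ <-]; rewrite -leeBlDr//.
have [c [a0c ac]] := directed_ub le_directed a0 a.
apply: net_liminf_ge; exists c => b cb; rewrite leeBlDr//.
apply: le_trans (vu b (directed_trans le_directed a0c cb)).
apply: ereal_inf_lbound; exists b => //.
exact: (directed_trans le_directed ac cb).
Qed.

Lemma le_net_limsup u v :
  (forall a, u a <= v a) -> net_limsup le u <= net_limsup le v.
Proof.
move=> uv; apply: net_limsup_le_addgt0 => e e0; apply: nearW => a.
by apply: (le_trans (uv a)); rewrite leeDl// lee_fin ltW.
Qed.

Lemma le_net_liminf u v :
  (forall a, u a <= v a) -> net_liminf le u <= net_liminf le v.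
Proof.
move=> uv; apply: net_liminf_le_addgt0 => e e0; apply: nearW => a.
by apply: (le_trans (uv a)); rewrite leeDl// lee_fin ltW.
Qed.

Lemma net_limsup_max u v :
  net_limsup le (fun a => maxe (u a) (v a)) <=
  maxe (net_limsup le u) (net_limsup le v).
Proof.
rewrite leNgt; apply/negP; rewrite gt_max.
move=> /andP[/ereal_inf_lt[_ [a _ <-] au] /ereal_inf_lt[_ [b _ <-] bv]].
have [c [ac bc]] := directed_ub le_directed a b.
(* Beyond a common upper bound [c] of [a] and [b], both nets stay below tail suprema that are
   smaller than the limsup of the maximum. This limsup would thus be smaller than itself. *)
have := lexx (net_limsup le (fun a => maxe (u a) (v a))).
apply/negP; rewrite -ltNge.
apply: (@le_lt_trans _ _
  (maxe (ereal_sup (u @` le a)) (ereal_sup (v @` le b)))).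
  apply: net_limsup_le; exists c => d cd; rewrite ge_max !le_max; apply/andP.
  split; apply/orP; [left|right]; apply: ereal_sup_ubound; exists d => //.
  - exact: (directed_trans le_directed ac cd).
  - exact: (directed_trans le_directed bc cd).
by rewrite gt_max au.
Qed.

(** One argument is constant here: for two oscillating nets the liminf of the maximum may exceed the
    maximum of the liminfs. *)
Lemma net_liminf_max_cst u (y : \bar R) :
  net_liminf le (fun a => maxe (u a) y) <= maxe (net_liminf le u) y.
Proof.
apply/ereal_supP => _ [a _ <-]; rewrite le_max.
case: (leP _ y) => [|yi]; rewrite ?orbT// orbF.
apply: net_liminf_ge; exists a => b ab.
have : ereal_inf [set maxe (u b) y | b in le a] <= maxe (u b) y.
  by apply: ereal_inf_lbound; exists b.
by rewrite le_max => /orP[//|/(lt_le_trans yi)]; rewrite ltxx.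
Qed.

Lemma net_limsupZ_le u v (r : R) : (0 < r)%R ->
  (forall a, r%:E * u a <= v a) -> r%:E * net_limsup le u <= net_limsup le v.
Proof.
move=> r0 uv; apply/ereal_infP => _ [a _ <-]; rewrite -lee_pdivlMl//.
apply: net_limsup_le; exists a => b ab; rewrite lee_pdivlMl//.
by apply: (le_trans (uv b)); apply: ereal_sup_ubound; exists b.
Qed.

Lemma net_liminfZ_le u v (r : R) : (0 < r)%R ->
  (forall a, r%:E * u a <= v a) -> r%:E * net_liminf le u <= net_liminf le v.
Proof.
move=> r0 uv; rewrite -lee_pdivlMl//; apply/ereal_supP => _ [a _ <-].
rewrite lee_pdivlMl//; apply: net_liminf_ge; exists a => b ab.
apply: le_trans (uv b); rewrite lee_pmul2l ?lte_fin//.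
by apply: ereal_inf_lbound; exists b.
Qed.

(** Links convergence along the filter of tails to the order-theoretic limits. Since [l] may be
    infinite, each bound is tested against real numbers [y], whose open rays are neighbourhoods of
    [l]. *)
Lemma net_cvg_liminf_limsup u l : u @ tails le --> l ->
  net_liminf le u = l /\ net_limsup le u = l.
Proof.
move=> ul.
have sup_le : net_limsup le u <= l.
  apply: lee_of_gt_fin => y ly; apply: net_limsup_le.
  have : \forall a \near tails le, u a < y%:E.
    by apply: (ul [set z | z < y%:E]); apply: open_nbhs_nbhs; split => //;
      exact: open_ereal_lt_ereal.
  by apply: filterS => a /ltW.
have le_inf : l <= net_liminf le u.
  apply: lee_of_lt_fin => y yl; apply: net_liminf_ge.
  have : \forall a \near tails le, y%:E < u a.
    by apply: (ul [set z | y%:E < z]); apply: open_nbhs_nbhs; split => //;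
      exact: open_ereal_gt_ereal.
  by apply: filterS => a /ltW.
have inf_sup := net_liminf_le_limsup u.
by split; apply/le_anti; rewrite ?le_inf ?sup_le ?andbT;
  [apply: le_trans sup_le|apply: le_trans le_inf _].
Qed.

End NetLimits.

(** * Exponential, logarithm and powers on the extended reals *)

Section ExpLne.
Context (R : realType).
Implicit Types x y : \bar R.

Lemma expeR_le_lne x y : 0 <= x -> (expeR y <= x) = (y <= lne x).
Proof.
move=> x0; rewrite -{1}(@lneK R x) ?lee_expeR//.
by rewrite in_itv /= x0 leey.
Qed.

Lemma lne_le_expeR x y : 0 <= x -> (x <= expeR y) = (lne x <= y).
Proof.
move=> x0; rewrite -{1}(@lneK R x) ?lee_expeR//.
by rewrite in_itv /= x0 leey.
Qed.

Lemma le_lne x y : 0 <= x -> x <= y -> lne x <= lne y.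
Proof.
move=> x0 xy; rewrite lee_lne// in_itv /= leey andbT//.
exact: le_trans xy.
Qed.

(** By monotonicity the preimage of a generating ray is a ray, or the whole line when the ray starts
    at a negative number. *)
Lemma measurable_expeR : measurable_fun [set: \bar R] (@expeR R).
Proof.
apply: (measurability _ (ErealGenOInfty.measurableE R)).
move=> /= _ [_ [r ->]] <-; apply: measurableI => //.
have [r0|r0] := ltP r 0%R.
  rewrite (_ : _ @^-1` _ = setT)//; apply/seteqP; split => // y _ /=.
  by rewrite in_itv /= andbT (lt_le_trans _ (expeR_ge0 y))// lte_fin.
rewrite (_ : _ @^-1` _ = `]lne r%:E, +oo[%classic).
  exact: emeasurable_itv.
apply/seteqP; split => y /=; rewrite !in_itv /= !andbT !ltNge;
  by rewrite expeR_le_lne ?lee_fin.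
Qed.

(** If [x <= y] then [x + y <= 2 * y], and the power is monotone and multiplicative. *)
Lemma poweRD_le_max x y (r : R) : 0 <= x -> 0 <= y -> (0 < r)%R ->
  poweR (x + y) r <= (2 `^ r)%:E * maxe (poweR x r) (poweR y r).
Proof.
move=> x0 y0 r0.
wlog xy : x y x0 y0 / x <= y.
  move=> wl; have [|/ltW] := leP x y; first exact: wl.
  by move=> /wl; rewrite addeC maxC; exact.
have itv (z : \bar R) : 0 <= z -> z \in `[0, +oo].
  by move=> z0; rewrite in_itv /= z0 leey.
have xyr : poweR x r <= poweR y r.
  by apply: (gt0_ler_poweR (ltW r0)); rewrite ?itv.
rewrite (max_idPr xyr) -poweR_EFin -poweRM ?lee_fin//.
apply: (gt0_ler_poweR (ltW r0)); rewrite ?itv ?adde_ge0 ?mule_ge0//.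
by rewrite mule_natl mule2n leeD2r.
Qed.

Lemma poweR_expeR_div (x : R) (r : R) : (0 < r)%R ->
  poweR (expR (r^-1 * x))%:E r = (expR x)%:E.
Proof.
by move=> r0; rewrite poweR_EFin -expRM mulrAC mulVf ?gt_eqF// mul1r.
Qed.

End ExpLne.

(** * Bump functions in logarithmic form *)

Section Bumps.
Context (R : realType) (X : ptopologicalType).
Implicit Types h : X -> \bar R.

(** Logarithms are taken separately on [G] and off [G]; positivity of [s] makes the maximum equal to
    1 on [G]. *)
Lemma below_bumpP (G : set X) (s : R) h : (0 < s)%R ->
  below_bump G s h <->
  (forall y, h y <= 0) /\ (forall y, ~ G y -> h y <= (- s)%:E).
Proof.
move=> s0; have es1 : (expR (- s) <= 1)%R by rewrite expR_le1 oppr_le0 ltW.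
split=> [hGs|[h0 hs] y].
  split=> y => [|Gy]; have := hGs y; rewrite indicE.
    rewrite -(lee_expeR (h y)) expeR0 => /le_trans; apply.
    rewrite lee_fin ge_max es1 andbT.
    by case: (_ \in _).
  rewrite memNset//= (max_idPr _) ?expR_ge0//.
  by rewrite -(lee_expeR (h y)).
rewrite indicE; case: (boolP (y \in G)) => [_|/negP Gy].
  by rewrite (max_idPl _)// -[1%:E](@expeR0 R) lee_expeR.
rewrite (max_idPr _) ?expR_ge0// -[_%:E]/(expeR (- s)%:E) lee_expeR.
by apply: hs => /mem_set.
Qed.

Lemma bump_ge (x : X) (G : set X) (s r : R) h :
  Defs.bump x G s r h -> (- r)%:E <= h x.
Proof.
by move=> [/(_ x) + _]; rewrite indicE mem_set// mulr1 -(lee_expeR (- r)%:E).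
Qed.

End Bumps.

(** * Powers of measures and of exponential integrals *)

Section Powers.
Context (R : realType) (X : ptopologicalType).
Context (I : Type) (le : I -> I -> Prop).
Hypothesis le_directed : directed le.
Context (mu : I -> probability (borel X) R) (t : I -> R).
Hypothesis t_gt0 : forall a, (0 < t a)%R.
Hypothesis t_cvg0 : t @ tails le --> (0 : R)%R.
Implicit Types (h : X -> \bar R) (A B G : set X).
#[local] Instance tails_filter : ProperFilter (tails le) :=
  tails_proper_filter le_directed.

Lemma open_borel A : open A -> measurable (A : set (borel X)).
Proof. by move=> oA; apply: sub_gen_smallest. Qed.

Lemma closed_borel A : closed A -> measurable (A : set (borel X)).
Proof.
move=> cA; rewrite -(setCK A); apply: measurableC.
by apply: open_borel; exact: closed_openC.
Qed.

Lemma continuous_borel h : continuous h ->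
  measurable_fun [set: borel X] (h : borel X -> \bar R).
Proof.
move=> ch; apply: (measurability _ (ErealGenOInfty.measurableE R)).
move=> /= _ [_ [r ->]] <-; apply: measurableI => //; apply: open_borel.
rewrite (_ : _ @^-1` _ = h @^-1` [set y | r%:E < y]).
  by apply: open_comp (@open_ereal_gt_ereal _ _) => x _; exact: ch.
by apply/seteqP; split => x /=; rewrite in_itv /= andbT.
Qed.

Lemma truncation_borel h M : continuous h ->
  measurable_fun [set: borel X] (truncation h M : borel X -> \bar R).
Proof.
move=> ch; apply: measurable_fun_ifT => //; last exact: continuous_borel.
by apply: measurable_fun_lte => //; exact: continuous_borel.
Qed.

Lemma measurable_expeR_scale h (r : R) :
  measurable_fun [set: borel X] (h : borel X -> \bar R) ->
  measurable_fun [set: borel X] (fun y : borel X => expeR (r%:E * h y)).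
Proof.
move=> mh; apply: (measurableT_comp (f := expeR)).
  exact: measurable_expeR.
exact: measurable_funeM.
Qed.

Lemma le_poweR (x y : \bar R) a :
  0 <= x -> x <= y -> poweR x (t a) <= poweR y (t a).
Proof.
move=> x0 xy; apply: (gt0_ler_poweR (ltW (t_gt0 a))) => //.
  by rewrite in_itv /= x0 leey.
by rewrite in_itv /= leey (le_trans x0).
Qed.

Lemma mu_pow_ge0 A a : 0 <= mu_pow mu t A a.
Proof. exact: poweR_ge0. Qed.

Lemma le_mu_pow A B a : measurable (A : set (borel X)) ->
  measurable (B : set (borel X)) -> A `<=` B ->
  mu_pow mu t A a <= mu_pow mu t B a.
Proof.
by move=> mA mB AB; apply: le_poweR => //; apply: le_measure; rewrite ?inE.
Qed.

Lemma mu_pow_le1 A a : measurable (A : set (borel X)) -> mu_pow mu t A a <= 1.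
Proof.
move=> mA; rewrite -(poweR1r (t a)); apply: le_poweR => //.
exact: probability_le1.
Qed.

Lemma mu_pow_set0 a : mu_pow mu t set0 a = 0.
Proof. by rewrite /mu_pow measure0 poweR0r// gt_eqF. Qed.

Lemma le_exp_pow h1 h2 a :
  measurable_fun [set: borel X] (h1 : borel X -> \bar R) ->
  measurable_fun [set: borel X] (h2 : borel X -> \bar R) ->
  (forall y, h1 y <= h2 y) -> exp_pow mu t h1 a <= exp_pow mu t h2 a.
Proof.
move=> mh1 mh2 h12; apply: le_poweR.
  by apply: integral_ge0 => y _; exact: expeR_ge0.
apply: ge0_le_integral => //.
- by move=> y _; exact: expeR_ge0.
- exact: measurable_expeR_scale.
- exact: measurable_expeR_scale.
- by move=> y _; rewrite lee_expeR lee_pmul2l// lte_fin invr_gt0.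
Qed.

(** A Chebyshev bound: the integrand is at least [expR ((t a)^-1 * q)] on [A], and the power [t a]
    turns this constant into [expR q]. *)
Lemma exp_pow_ge h A (q : R) a :
  measurable_fun [set: borel X] (h : borel X -> \bar R) ->
  measurable (A : set (borel X)) -> (forall y, A y -> q%:E <= h y) ->
  (expR q)%:E * mu_pow mu t A a <= exp_pow mu t h a.
Proof.
move=> mh mA qh.
rewrite -(poweR_expeR_div q (t_gt0 a)) -poweRM ?lee_fin ?expR_ge0//.
apply: le_poweR; first by rewrite mule_ge0// lee_fin expR_ge0.
rewrite -integral_cst// integral_mkcond; apply: ge0_le_integral => //.
- by move=> y _; rewrite patchE; case: ifP; rewrite // lee_fin expR_ge0.
- by apply/(measurable_restrictT _ mA); exact: measurable_cst.
- exact: measurable_expeR_scale.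
move=> y _; rewrite patchE.
case: ifPn => [/set_mem Ay|_]; last exact: expeR_ge0.
rewrite -[leLHS]/(expeR ((t a)^-1 * q)%:E) lee_expeR EFinM.
by rewrite lee_pmul2l ?lte_fin ?invr_gt0// qh.
Qed.

(** The integrand is at most the indicator of [G] plus the constant [expR ((t a)^-1 * - s)];
    [poweRD_le_max] then bounds the power of the sum. *)
Lemma exp_pow_le h G (s : R) a : (0 < s)%R ->
  measurable_fun [set: borel X] (h : borel X -> \bar R) ->
  measurable (G : set (borel X)) -> below_bump G s h ->
  exp_pow mu t h a <= (2 `^ t a)%:E * maxe (mu_pow mu t G a) (expR (- s))%:E.
Proof.
move=> s0 mh mG /(below_bumpP G h s0)[h0 hs].
rewrite -(poweR_expeR_div (- s) (t_gt0 a)).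
apply: le_trans; last by apply: poweRD_le_max; rewrite ?lee_fin ?expR_ge0.
apply: le_poweR; first by apply: integral_ge0 => y _; exact: expeR_ge0.
rewrite -[X in _ <= mu a X + _]setIT -(integral_indic (mu a) measurableT mG).
(* Total mass one makes the constant its own integral, so that both terms can be joined under one
   integral sign. *)
have -> : (expR ((t a)^-1 * - s))%:E =
    \int[mu a]_(y in [set: borel X]) (cst (expR ((t a)^-1 * - s))%:E y).
  rewrite integral_cst//.
  by rewrite -[LHS]mule1; congr (_ * _); rewrite -(probability_setT (mu a)).
rewrite -ge0_integralD//; last 2 first.
- by apply/measurable_EFinP; exact: measurable_indic.
- by move=> y _; rewrite lee_fin expR_ge0.
apply: ge0_le_integral => //.
- by move=> y _; exact: expeR_ge0.
- exact: measurable_expeR_scale.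
- apply: emeasurable_funD => //; apply/measurable_EFinP.
  exact: measurable_indic.
have ta0 : 0 < ((t a)^-1)%:E by rewrite lte_fin invr_gt0.
move=> y _; rewrite indicE; case: (boolP (y \in G)) => [_|/negP Gy].
  apply: (@le_trans _ _ 1); last by rewrite leeDl// lee_fin expR_ge0.
  by rewrite -expeR0 lee_expeR -(mule0 ((t a)^-1)%:E) lee_pmul2l.
rewrite add0e -[leRHS]/(expeR ((t a)^-1 * - s)%:E) lee_expeR EFinM lee_pmul2l//.
by apply: hs => /mem_set.
Qed.

Lemma near_pow2_le (e : R) : (0 < e)%R ->
  \forall a \near tails le, (2 `^ t a <= 1 + e)%R.
Proof.
move=> e0.
have cvg0 : (t a * ln 2)%R @[a --> tails le] --> (0 : R)%R.
  by rewrite -(mul0r (ln 2)); apply: cvgM => //; exact: cvg_cst.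
have /cvgrPdist_le/(_ e e0) := cvg_comp _ _ cvg0 (@continuous_expR R 0%R).
rewrite expR0; apply: filterS => a; rewrite /powR pnatr_eq0 /= distrC.
by move=> /(le_trans (ler_norm _)); rewrite lerBlDl.
Qed.

(** As [u] is bounded by 1, the eventual factor [1 + e] costs at most an additive [e]. *)
Lemma near_le_pow2 (u v : I -> \bar R) : (forall a, 0 <= u a <= 1) ->
  (forall a, v a <= (2 `^ t a)%:E * u a) ->
  forall e : R, (0 < e)%R -> \forall a \near tails le, v a <= u a + e%:E.
Proof.
move=> u01 vu e e0; near=> a; apply: (le_trans (vu a)).
have /andP[ua0 ua1] := u01 a.
apply: (@le_trans _ _ ((1 + e)%:E * u a)).
  rewrite lee_wpmul2r// lee_fin; near: a; exact: near_pow2_le.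
rewrite EFinD ge0_muleDl ?lee_fin ?(ltW e0)// mul1e; apply: leeD2l.
by rewrite -[leRHS]mule1 lee_wpmul2l// lee_fin ltW.
Unshelve. all: by end_near. Qed.

Lemma net_limsup_mu_pow_le1 A : measurable (A : set (borel X)) ->
  net_limsup le (mu_pow mu t A) <= 1.
Proof.
by move=> mA; apply: net_limsup_le; apply: nearW => a; exact: mu_pow_le1.
Qed.

Lemma net_liminf_ge0 u : (forall a, 0 <= u a) -> 0 <= net_liminf le u :> \bar R.
Proof. by move=> u0; apply: net_liminf_ge; exact: nearW. Qed.

Lemma net_limsup_ge0 u : (forall a, 0 <= u a) -> 0 <= net_limsup le u :> \bar R.
Proof.
move=> u0; apply: le_trans (net_liminf_le_limsup le_directed u).
exact: net_liminf_ge0.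
Qed.

Lemma le_limsup_mu_pow A B : measurable (A : set (borel X)) ->
  measurable (B : set (borel X)) -> A `<=` B ->
  net_limsup le (mu_pow mu t A) <= net_limsup le (mu_pow mu t B).
Proof. by move=> mA mB AB; apply: le_net_limsup => // a; exact: le_mu_pow. Qed.

Lemma limsup_mu_powU A B : measurable (A : set (borel X)) ->
  measurable (B : set (borel X)) ->
  net_limsup le (mu_pow mu t (A `|` B)) <=
  maxe (net_limsup le (mu_pow mu t A)) (net_limsup le (mu_pow mu t B)).
Proof.
move=> mA mB; apply: le_trans (net_limsup_max le_directed _ _).
apply: (net_limsup_le_addgt0 le_directed); apply: near_le_pow2 => a.
  by rewrite le_max mu_pow_ge0 /= ge_max !mu_pow_le1.
apply: le_trans (poweRD_le_max _ _ (t_gt0 a)) => //.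
by apply: le_poweR => //; exact: measureU2.
Qed.

(** Maxitivity, by induction on a list enumerating [D]; [0 <= y] covers the empty union. The map [F]
    is meant to be [id] or [closure]. *)
Lemma limsup_mu_pow_bigcup (F : set X -> set X) (D : set (set X)) (y : \bar R) :
  finite_set D -> 0 <= y ->
  (forall G, D G -> measurable (F G : set (borel X)) /\
     net_limsup le (mu_pow mu t (F G)) <= y) ->
  measurable (\bigcup_(G in D) F G : set (borel X)) /\
  net_limsup le (mu_pow mu t (\bigcup_(G in D) F G)) <= y.
Proof.
move=> /finite_seqP[r ->] y0; rewrite bigcup_seq.
elim: r => [_|G r IH FGy].
  rewrite big_nil; split => //; apply: net_limsup_le; apply: nearW => a.
  by rewrite mu_pow_set0.
have [|mr ry] := IH.
  by move=> G' G'r; apply: FGy; rewrite /= inE G'r orbT.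
have [|mG Gy] := FGy G; first by rewrite /= inE eqxx.
rewrite big_cons; split; first exact: measurableU.
by apply: (le_trans (limsup_mu_powU mG mr)); rewrite ge_max Gy.
Qed.

Lemma limsup_exp_pow_ge h G (q : R) : continuous h -> open G ->
  (forall y, G y -> q%:E <= h y) ->
  (expR q)%:E * net_limsup le (mu_pow mu t G) <= net_limsup le (exp_pow mu t h).
Proof.
move=> ch oG qh; apply: net_limsupZ_le => //; first exact: expR_gt0.
move=> a; apply: exp_pow_ge => //; first exact: continuous_borel.
exact: open_borel.
Qed.

Lemma limsup_exp_pow_le h G (s : R) : (0 < s)%R -> continuous h -> open G ->
  below_bump G s h ->
  net_limsup le (exp_pow mu t h) <=
  maxe (net_limsup le (mu_pow mu t G)) (expR (- s))%:E.
Proof.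
move=> s0 ch oG hGs; have mG := open_borel oG; have mh := continuous_borel ch.
apply: (@le_trans _ _ (net_limsup le
    (fun a => maxe (mu_pow mu t G a) (expR (- s))%:E))).
  apply: (net_limsup_le_addgt0 le_directed); apply: near_le_pow2 => a.
    rewrite le_max mu_pow_ge0 /= ge_max mu_pow_le1//= lee_fin.
    by rewrite expR_le1 oppr_le0 ltW.
  exact: exp_pow_le.
apply: (le_trans (net_limsup_max le_directed _ _)).
rewrite ge_max !le_max lexx /=; apply/orP; right.
by apply: net_limsup_le; exact: nearW.
Qed.

Lemma liminf_exp_pow_le h G (s : R) : (0 < s)%R -> continuous h -> open G ->
  below_bump G s h ->
  net_liminf le (exp_pow mu t h) <=
  maxe (net_liminf le (mu_pow mu t G)) (expR (- s))%:E.
Proof.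
move=> s0 ch oG hGs; have mG := open_borel oG; have mh := continuous_borel ch.
apply: le_trans (net_liminf_max_cst le _ _).
apply: (net_liminf_le_addgt0 le_directed); apply: near_le_pow2 => a.
  rewrite le_max mu_pow_ge0 /= ge_max mu_pow_le1//= lee_fin.
  by rewrite expR_le1 oppr_le0 ltW.
exact: exp_pow_le.
Qed.

End Powers.

(** * Exponential tightness and the finite cover condition *)

Lemma compact_finite_cover (X : ptopologicalType) (K : set X)
    (C : set (set X)) :
  compact K -> (forall G, C G -> open G) -> K `<=` \bigcup_(G in C) G ->
  exists D : set (set X),
    [/\ finite_set D, D `<=` C & K `<=` \bigcup_(G in D) G].
Proof.
rewrite compact_cover => cK oC KC.
have [D DC KD] := cK _ C id oC KC.
exists [set` D]; split => //.
by move=> G /= /DC /set_mem.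
Qed.

Section Tightness.
Context (R : realType) (X : ptopologicalType).
Hypothesis compact_borel :
  forall K : set X, compact K -> measurable (K : set (borel X)).
Context (I : Type) (le : I -> I -> Prop).
Hypothesis le_directed : directed le.
Context (mu : I -> probability (borel X) R) (t : I -> R).
Hypothesis t_gt0 : forall a, (0 < t a)%R.
Hypothesis t_cvg0 : t @ tails le --> (0 : R)%R.

Lemma l0_infty_small (x : X) (e : R) : (0 < e)%R -> l0 le mu t x = +oo ->
  exists G, [/\ open G, G x & net_limsup le (mu_pow mu t G) < e%:E].
Proof.
move=> e0 /eqe_oppLRP /= l0x.
suff /ereal_inf_lt[_ [G [oG Gx] <-] Ge] : ereal_inf
    [set net_limsup le (mu_pow mu t G) | G in [set G | open G /\ G x]] < e%:E.
  by exists G.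
rewrite ltNge; apply/negP => /le_lne; rewrite lee_fin l0x lne_EFin//.
by move=> /(_ (ltW e0)).
Qed.

(** The hypothesis is a common consequence of (i) and (ii). The compact set [K] meets [F] in points
    covered by [C] and in points with [l0] infinite, which have open neighbourhoods of small limsup.
    By maxitivity these neighbourhoods and the complement of [K] contribute less than [e]. *)
Lemma finite_cover_condition_of_compact :
  (forall e : R, (0 < e)%R -> exists K : set X,
     [/\ compact K, (forall x, K x -> ~ X0 R X x -> l0 le mu t x = +oo) &
         net_limsup le (mu_pow mu t (~` K)) < e%:E]) ->
  finite_cover_condition le mu t.
Proof.
rewrite /finite_cover_condition => tight /= F C e cF oC FC e0.
have [K [cK K0 Ke]] := tight e e0.
(* The union lemma yields a large inequality; the bound [e / 2] keeps the final one strict. *)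
pose small G := open G /\ net_limsup le (mu_pow mu t G) <= (e / 2)%:E.
have [|||D [finD DC FKD]] := @compact_finite_cover _ (K `&` F) (C `|` small).
- exact: compact_closedI.
- by move=> G [/oC//|[]].
- move=> x [Kx Fx]; have [X0x|X0x] := pselect (X0 R X x).
    by have [G CG Gx] := FC x (conj Fx X0x); exists G => //; left.
  have e20 : (0 < e / 2)%R by rewrite divr_gt0.
  have [G [oG Gx Ge]] := l0_infty_small e20 (K0 x Kx X0x).
  by exists G => //; right; split => //; exact: ltW.
exists (D `&` C); split; [exact: finite_setIl|exact: subIsetr|].
have [|||mE Ee] := @limsup_mu_pow_bigcup _ _ _ _ le_directed mu t t_gt0 t_cvg0
  id (D `&` small) (e / 2)%:E.
- exact: finite_setIl.
- by rewrite lee_fin divr_ge0// ltW.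
- by move=> G [_ [oG Ge]]; split => //; exact: open_borel.
(* Only measurability of the finite union of closures is wanted, so the trivial bound 1 serves. *)
have [|||mU _] := @limsup_mu_pow_bigcup _ _ _ _ le_directed mu t t_gt0 t_cvg0
  closure (D `&` C) 1.
- exact: finite_setIl.
- by [].
- move=> G _; have mG : measurable (closure G : set (borel X)).
    by apply: closed_borel; exact: closed_closure.
  by split => //; exact: net_limsup_mu_pow_le1.
have mK : measurable (~` K : set (borel X)).
  by apply: measurableC; exact: compact_borel.
set E := \bigcup_(G in D `&` small) id G in mE Ee.
have mB := measurableU _ _ mE mK.
set U := \bigcup_(G in D `&` C) closure G in mU *.
have L0 : 0 <= net_limsup le (mu_pow mu t U).
  by apply: net_limsup_ge0 => // a; exact: mu_pow_ge0.
have L1 : net_limsup le (mu_pow mu t U) <= 1 by exact: net_limsup_mu_pow_le1.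
have Lfin : net_limsup le (mu_pow mu t U) \is a fin_num.
  by rewrite ge0_fin_numE// (le_lt_trans L1)// ltry.
rewrite lteBlDr//.
apply: (@le_lt_trans _ _ (maxe (net_limsup le (mu_pow mu t U))
   (maxe (e / 2)%:E (net_limsup le (mu_pow mu t (~` K)))))).
  apply: (@le_trans _ _ (net_limsup le (mu_pow mu t
      (U `|` (E `|` ~` K))))).
    apply: le_limsup_mu_pow => //; [exact: closed_borel|exact: measurableU|].
    move=> x Fx; have [Kx|Kx] := pselect (K x); last by right; right.
    have [G DG Gx] := FKD x (conj Kx Fx).
    have [CG|sG] := DC G DG; last by right; left; exists G.
    by left; exists G => //; exact: subset_closure.
  apply: (le_trans (limsup_mu_powU le_directed mu t_gt0 t_cvg0 mU mB)). 
  rewrite ge_max !le_max lexx /=.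
  apply/orP; right; rewrite -le_max.
  apply: (le_trans (limsup_mu_powU le_directed mu t_gt0 t_cvg0 mE mK)).
  by rewrite ge_max !le_max Ee lexx orbT.
have e2e : (e / 2 < e)%R by rewrite ltr_pdivrMr// mulr_natr mulr2n ltrDl.
rewrite !gt_max; apply/and3P; split.
- by rewrite lteDr// lte_fin.
- by rewrite (lt_le_trans _ (leeDl _ L0))// lte_fin.
- by rewrite (lt_le_trans Ke)// leeDl.
Qed.

(** A point outside [X0] lies in the complement of every compact [K] contained in [X0]. That
    complement is open because [K] is closed, and its limsup can be made arbitrarily small. *)
Lemma X0_tight_l0_infty : (forall K : set X, compact K -> closed K) ->
  X0_exponentially_tight le mu t -> forall x, ~ X0 R X x -> l0 le mu t x = +oo.
Proof.
move=> cK_closed tight x X0x; rewrite /l0.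
suff -> : ereal_inf
    [set net_limsup le (mu_pow mu t G) | G in [set G | open G /\ G x]] = 0.
  by rewrite le0_lneNy.
apply/le_anti/andP; split; last first.
  apply/ereal_infP => _ [G _ <-]; apply: net_limsup_ge0 => // a.
  exact: mu_pow_ge0.
apply/lee_addgt0Pr => e e0; rewrite add0e.
have [K [cK KX0 Ke]] := tight e e0.
apply: ge_ereal_inf.
exists (net_limsup le (mu_pow mu t (~` K))); last exact: ltW.
exists (~` K) => //; split; last by move=> /KX0.
by apply: closed_openC; exact: cK_closed.
Qed.

End Tightness.

(** * The function [l0] and its comparison with [Lambda] through bump functions *)

Section RateFunction.
Context (R : realType) (X : ptopologicalType).
Context (I : Type) (le : I -> I -> Prop).
Hypothesis le_directed : directed le.
Context (mu : I -> probability (borel X) R) (t : I -> R).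
Hypothesis t_gt0 : forall a, (0 < t a)%R.
Hypothesis t_cvg0 : t @ tails le --> (0 : R)%R.
Implicit Types (h l : X -> \bar R) (G : set X) (T : set (X -> \bar R)).

Let L G := net_limsup le (mu_pow mu t G).

Let inf_ge0 x : 0 <= ereal_inf [set L G | G in [set G | open G /\ G x]].
Proof.
apply/ereal_infP => _ [G _ <-]; apply: net_limsup_ge0 => // a.
exact: mu_pow_ge0.
Qed.

Lemma l0_ge G x : open G -> G x ->
  - lne (net_limsup le (mu_pow mu t G)) <= l0 le mu t x.
Proof.
move=> oG Gx; rewrite leeN2; apply: le_lne => //.
by apply: ereal_inf_lbound; exists G.
Qed.

(** With [l0_ge], this describes [l0 x] as a supremum over the open neighbourhoods of [x]: the
    logarithm carries the infimum in the definition to a supremum after the change of sign. *)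
Lemma l0_le x z :
  (forall G, open G -> G x -> - lne (net_limsup le (mu_pow mu t G)) <= z) ->
  l0 le mu t x <= z.
Proof.
move=> Lz; rewrite leeNl -expeR_le_lne//; apply/ereal_infP => _ [G [oG Gx] <-].
rewrite expeR_le_lne; first by rewrite leeNl; exact: Lz.
by apply: net_limsup_ge0 => // a; exact: mu_pow_ge0.
Qed.

Lemma l0_ge0 x : 0 <= l0 le mu t x.
Proof.
apply: (le_trans _ (@l0_ge setT x openT _)) => //.
by rewrite oppe_ge0 lne_le0; apply: net_limsup_mu_pow_le1.
Qed.

Lemma expeR_l0 x : expeR (- l0 le mu t x) =
  ereal_inf [set net_limsup le (mu_pow mu t G) | G in [set G | open G /\ G x]].
Proof. by rewrite oppeK; apply/eqP; rewrite lneK_eq; exact: inf_ge0. Qed.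

Lemma lne_ge_add (q : R) (i e : \bar R) : 0 <= i -> 0 <= e ->
  (expR q)%:E * i <= e -> q%:E + lne i <= lne e.
Proof.
move=> i0 e0 qie; rewrite -expeR_le_lne// expeRD /=.
by have /eqP -> : expeR (lne i) == i by rewrite lneK_eq.
Qed.

Lemma opp_lne_ge_min (s : R) (i e : \bar R) : 0 <= i -> 0 <= e ->
  e <= maxe i (expR (- s))%:E -> mine (- lne i) s%:E <= - lne e.
Proof.
move=> i0 e0; rewrite le_max ge_min => /orP[/(le_lne e0) ei|].
  by rewrite leeN2 ei.
rewrite -[_%:E]/(expeR (- s)%:E) lne_le_expeR// EFinN leeNr => ->.
by rewrite orbT.
Qed.

(** Letting [s] grow removes the floor [expR (- s)] left by the bump functions off [G]. *)
Lemma le_of_min_le (y z : \bar R) :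
  (forall s : R, (0 < s)%R -> mine y s%:E <= z) -> y <= z.
Proof.
move=> yz; apply: lee_of_lt_fin => a ay.
have s0 : (0 < Num.max a 1)%R by rewrite lt_max ltr01 orbT.
by apply: le_trans (yz _ s0); rewrite le_min ltW//= lee_fin le_max lexx.
Qed.

Lemma exp_pow_ge0 h a : 0 <= exp_pow mu t h a.
Proof. exact: poweR_ge0. Qed.

(** With the slack [e] the inequality at [x] becomes strict, so by continuity it holds on an open
    neighbourhood [G], where the Chebyshev bound applies. *)
Lemma opp_Lambda_sup_le h x (r : R) : continuous h -> (- r)%:E <= h x ->
  - Lambda_sup le mu t h <= r%:E + l0 le mu t x.
Proof.
move=> ch rh; apply/lee_addgt0Pr => e e0.
pose G := h @^-1` [set y | (- (r + e))%:E < y].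
have oG : open G.
  by apply: open_comp (@open_ereal_gt_ereal _ _) => y _; exact: ch.
have Gx : G x.
  by apply: lt_le_trans rh; rewrite lte_fin ltrN2 ltrDl.
have hG y : G y -> (- (r + e))%:E <= h y by move=> /ltW.
have L0 : 0 <= L G by apply: net_limsup_ge0 => // a; exact: mu_pow_ge0.
have E0 : 0 <= net_limsup le (exp_pow mu t h).
  by apply: net_limsup_ge0 => // a; exact: exp_pow_ge0.
have qL := lne_ge_add L0 E0 (limsup_exp_pow_ge le mu t_gt0 ch oG hG).
rewrite addeAC -EFinD; apply: (@le_trans _ _ ((r + e)%:E - lne (L G))).
  by rewrite leeNl addeC fin_num_oppeD// oppeK addeC -EFinN.
by rewrite leeD2l//; exact: l0_ge.
Qed.

Lemma opp_Lambda_sup_ge h G (s : R) : (0 < s)%R -> continuous h -> open G ->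
  below_bump G s h ->
  mine (- lne (net_limsup le (mu_pow mu t G))) s%:E <= - Lambda_sup le mu t h.
Proof.
move=> s0 ch oG hGs; apply: opp_lne_ge_min.
- by apply: net_limsup_ge0 => // a; exact: mu_pow_ge0.
- by apply: net_limsup_ge0 => // a; exact: exp_pow_ge0.
- exact: limsup_exp_pow_le.
Qed.

Lemma opp_Lambda_inf_ge h G (s : R) : (0 < s)%R -> continuous h -> open G ->
  below_bump G s h ->
  mine (- lne (net_liminf le (mu_pow mu t G))) s%:E <= - Lambda_inf le mu t h.
Proof.
move=> s0 ch oG hGs; apply: opp_lne_ge_min.
- by apply: net_liminf_ge0 => // a; exact: mu_pow_ge0.
- by apply: net_liminf_ge0 => // a; exact: exp_pow_ge0.
- exact: liminf_exp_pow_le.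
Qed.

Lemma Lambda_existsE h : Lambda_exists le mu t h ->
  Lambda le mu t h = Lambda_sup le mu t h /\
  Lambda_inf le mu t h = Lambda_sup le mu t h.
Proof.
move=> /(net_cvg_liminf_limsup le_directed)[infE supE].
by rewrite /Lambda /Lambda_sup /Lambda_inf infE supE.
Qed.

(** The common pattern of the three formulas on [X0]: [V] is minus [Lambda_sup] on [tail_part T],
    minus [Lambda] on [negative_part T], or the limit over truncations on [T]. Small [r] gives one
    inequality, small [G] and large [s] the other. *)
Lemma inf_sup_eq_l0 (x : X) (S : set (X -> \bar R))
    (V : (X -> \bar R) -> \bar R) :
  (forall h (r : R), (0 < r)%R -> S h -> (- r)%:E <= h x ->
     V h <= r%:E + l0 le mu t x) ->
  (forall G (s r : R), open G -> G x -> (0 < s)%R -> (0 < r)%R ->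
     exists h, [/\ S h, (- r)%:E <= h x &
       mine (- lne (net_limsup le (mu_pow mu t G))) s%:E <= V h]) ->
  ereal_inf [set ereal_sup [set V h | h in [set h | S h /\ (- r)%:E <= h x]]
            | r in [set r : R | (0 < r)%R]] = l0 le mu t x.
Proof.
move=> Vle Vge; apply/le_anti/andP; split.
  apply/lee_addgt0Pr => e e0; apply: ge_ereal_inf.
  eexists; first by exists e.
  by apply/ereal_supP => _ [h [Sh hx] <-]; rewrite addeC; exact: Vle.
apply/ereal_infP => _ [r r0 <-]; apply: l0_le => G oG Gx.
apply: le_of_min_le => s s0; have [h [Sh hx hV]] := Vge G s r oG Gx s0 r0.
by apply: (le_trans hV); apply: ereal_sup_ubound; exists h.
Qed.

Lemma bump_le0 x G (s r : R) h : (0 < s)%R -> Defs.bump x G s r h ->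
  forall y, h y <= 0.
Proof. by move=> s0 [_ /(below_bumpP G h s0)[]]. Qed.

(** For [M > 1] the set where [expeR (h x)] is at least [M] is empty. *)
Lemma tail_part_le0 T h : T h -> (forall y, h y <= 0) -> tail_part le mu t T h.
Proof.
move=> Th h0; split => //; apply: cvg_near_cst.
have tailsF := tails_proper_filter le_directed.
near=> M.
have -> : [set x | M%:E <= expeR (h x)] = set0.
  apply/seteqP; split => // y /=; apply/negP; rewrite -ltNge.
  apply: (@le_lt_trans _ _ 1); first by rewrite -expeR0 lee_expeR.
  by rewrite lte_fin; near: M; exact: nbhs_pinfty_gt.
rewrite (_ : exp_pow_on _ _ _ _ = fun=> 0).
  apply/le_anti/andP; split; first by apply: net_limsup_le; apply: nearW.
  exact: net_limsup_ge0.
by apply/funext => a; rewrite /exp_pow_on integral_set0 poweR0r// gt_eqF.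
Unshelve. all: by end_near. Qed.

(** * The two branches of [l_class] and their agreement on [X0] *)

Lemma approximating_negative_part T :
  approximating T -> approximating (negative_part T).
Proof.
move=> [cT aT]; split=> [h [/cT]//|x G s r X0x oG Gx s0 r0].
have [h Th hb] := aT x G s r X0x oG Gx s0 r0.
by exists h => //; split => //; exact: bump_le0 hb.
Qed.

Lemma l_in_l0 T x : approximating T -> X0 R X x ->
  l_in le mu t T x = l0 le mu t x.
Proof.
move=> [cT aT] X0x; apply: inf_sup_eq_l0 => [h r r0 [Th _]|G s r oG Gx s0 r0].
  by apply: opp_Lambda_sup_le; have [] := cT h Th.
have [h Th hb] := aT x G s r X0x oG Gx s0 r0.
exists h; split; [|exact: bump_ge hb|].
- by apply: tail_part_le0 => //; exact: bump_le0 hb.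
- by apply: opp_Lambda_sup_ge => //; [have [] := cT h Th|exact: hb.2].
Qed.

(** This holds also off [X0]: every member of [T_Gs T G s] lies below the same bump, whatever its
    base point, and an empty family has infimum [+oo]. *)
Lemma l_out_ge_l0 T x : approximating T -> l0 le mu t x <= l_out le mu t T x.
Proof.
move=> [cT _]; apply: l0_le => G oG Gx; apply: le_of_min_le => s s0.
apply: le_ereal_sup_tmp; eexists; first by exists G.
apply: le_ereal_sup_tmp; eexists; first by exists s.
apply/ereal_infP => _ [h [y [r [Gy X0y r0 Th [hb _]]]] <-].
by apply: opp_Lambda_sup_ge => //; have [] := cT h Th.
Qed.

(** On [X0] the point [x] itself serves as base point of a member of [T_Gs T G s], with height loss
    [e]. *)
Lemma l_out_le_l0 T x : approximating T -> X0 R X x ->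
  l_out le mu t T x <= l0 le mu t x.
Proof.
move=> [cT aT] X0x; apply/ereal_supP => _ [G [oG Gx] <-].
apply/ereal_supP => _ [s s0 <-]; apply/lee_addgt0Pr => e e0.
have [h Th hb] := aT x G s e X0x oG Gx s0 e0.
apply: ge_ereal_inf; exists (- Lambda_sup le mu t h).
  exists h => //; exists x, e; split => //.
  by split; [exact: hb.2|exact: bump_ge hb].
rewrite addeC; apply: opp_Lambda_sup_le; last exact: bump_ge hb.
by have [] := cT h Th.
Qed.

Lemma l_class_l_out T x : approximating T ->
  l_class le mu t T x = l_out le mu t T x.
Proof.
move=> aT; rewrite /l_class; case: ifPn => // /set_mem X0x.
rewrite l_in_l0//; apply/le_anti.
by rewrite l_out_ge_l0// l_out_le_l0.
Qed.

Lemma l_class_l0 T x : approximating T -> X0 R X x ->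
  l_class le mu t T x = l0 le mu t x.
Proof. by move=> aT X0x; rewrite /l_class mem_set// l_in_l0. Qed.

(** The quantity attached to [G] does not depend on [x], and [G] is a neighbourhood of each of its
    points. *)
Lemma lower_semicontinuous_l_out T : lower_semicontinuous (l_out le mu t T).
Proof.
move=> x a /ereal_sup_gt[_ [G [oG Gx] <-] aG].
exists G; first exact: open_nbhs_nbhs.
move=> y Gy; apply: (lt_le_trans aG); apply: ereal_sup_ubound.
by exists G.
Qed.

Lemma T_Gs_negative_part T G (s : R) : (0 < s)%R ->
  T_Gs T G s = T_Gs (negative_part T) G s.
Proof.
move=> s0; apply/seteqP; split => h [x [r [Gx X0x r0 Th [hb hx]]]];
  exists x, r; split => //; last by case: Th.
by split => //; have [] := (below_bumpP G h s0).1 hb.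
Qed.

Lemma l_out_negative_part T x : approximating T ->
  l_out le mu t T x = l_out le mu t (negative_part T) x.
Proof.
move=> aT; congr ereal_sup; apply: eq_imagel => G _; congr ereal_sup.
by apply: eq_imagel => s s0; rewrite T_Gs_negative_part.
Qed.

(** Functions below a bump are nonpositive, so their [Lambda] exists and [Lambda_inf] may replace
    [Lambda_sup]; the liminf form of the bump bound then applies. *)
Lemma l_out_ge_liminf T G x : approximating T ->
  (forall h, negative_part T h -> Lambda_exists le mu t h) ->
  open G -> G x -> - lne (net_liminf le (mu_pow mu t G)) <= l_out le mu t T x.
Proof.
move=> aT exT oG Gx; rewrite l_out_negative_part//; apply: le_of_min_le => s s0.
apply: le_ereal_sup_tmp; eexists; first by exists G.
apply: le_ereal_sup_tmp; eexists; first by exists s.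
apply/ereal_infP => _ [h [y [r [Gy X0y r0 Th [hb _]]]] <-].
have [_ <-] := Lambda_existsE (exT h Th).
by apply: opp_Lambda_inf_ge => //; have [/(_ _ Th.1)[]] := aT.
Qed.

(** * The large deviation bounds *)

Lemma ldp_upper_bound F : finite_cover_condition le mu t -> closed F ->
  net_limsup le (mu_pow mu t F) <=
  sup_ge0 [set expeR (- l0 le mu t x) | x in F `&` X0 R X].
Proof.
move=> fcc cF; set m := sup_ge0 _; apply/lee_addgt0Pr => e e0.
have e20 : (0 < e / 2)%R by rewrite divr_gt0.
have m0 : 0 <= m by apply: ereal_sup_ubound; right.
have [->|/eqP moo] := eqVneq m +oo; first by rewrite leey.
have mfin : m \is a fin_num by rewrite ge0_fin_numE// ltey; exact/eqP.
(* Condition (iii) returns closures of the covering sets; each closure is kept inside an open set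
   whose limsup is already controlled. *)
pose C V := open V /\
  exists G, [/\ open G, closure V `<=` G & L G <= m + (e / 2)%:E].
have [||D [finD DC FD]] := fcc F C (e / 2)%R cF _ _ e20.
- by move=> V [].
- move=> x [Fx X0x].
  have : expeR (- l0 le mu t x) < m + (e / 2)%:E.
    apply: (@le_lt_trans _ _ m); last by rewrite lteDl// lte_fin.
    by apply: ereal_sup_ubound; left; exists x.
  rewrite expeR_l0 => /ereal_inf_lt[_ [G [oG Gx] <-] Gm].
  (* Here [f x] is at least -1/4, while [f] is at most -1 off [G]. The level -1/2 separates them:
     the closed set where [f] is at least -1/2 contains [V] and lies in [G]. *)
  have [f [cf _ fb]] := X0x G 1%R 4^-1%R oG Gx ltr01 ltac:(by rewrite invr_gt0).
  pose V := f @^-1` [set z | (- 2^-1 < z)%R].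
  have oV : open V by apply: open_comp (@open_gt _ _) => y _; exact: cf.
  exists V; last first.
    rewrite /V /=; have := bump_ge fb; rewrite /= lee_fin; apply: lt_le_trans.
    by rewrite ltrN2 ltf_pV2 ?posrE// ltr_nat.
  split => //; exists G; split => //; last exact: ltW.
  have cV : closed (f @^-1` [set z | (- 2^-1 <= z)%R]).
    by apply: closed_comp (@closed_ge _ _) => y _; exact: cf.
  have VW : V `<=` f @^-1` [set z | (- 2^-1 <= z)%R] by move=> y /ltW.
  move=> y /(closureS VW); rewrite -(closure_id _).1// => fy.
  apply: contrapT => Gy; have := ((below_bumpP G _ ltr01).1 fb.2).2 y Gy.
  rewrite /= lee_fin => /(le_trans fy); rewrite lerN2 leNgt.
  by rewrite invf_lt1// ltr1n.
have [|||mU Um] := @limsup_mu_pow_bigcup _ _ _ _ le_directed mu t t_gt0 t_cvg0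
  closure D (m + (e / 2)%:E).
- by [].
- by rewrite adde_ge0// lee_fin ltW.
- move=> V /DC[_ [G [oG VG Gm]]].
  have mV : measurable (closure V : set (borel X)).
    by apply: closed_borel; exact: closed_closure.
  split => //; apply: le_trans Gm; apply: le_limsup_mu_pow => //.
  exact: open_borel.
have Ufin :
    net_limsup le (mu_pow mu t (\bigcup_(G in D) closure G)) \is a fin_num.
  rewrite ge0_fin_numE; last first.
    by apply: net_limsup_ge0 => // a; exact: mu_pow_ge0.
  apply: (le_lt_trans (net_limsup_mu_pow_le1 le_directed mu t_gt0 mU)).
  by rewrite ltry.
move: FD; rewrite lteBlDr// => /ltW/le_trans; apply.
by rewrite [in leRHS](splitr e) EFinD addeA addeC leeD2l.
Qed.

(** The upper bound only looks at [l] on [X0], and the lower bound only asks that [l] dominate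
    [l_out]. This leaves room for values as large as [+oo] off [X0]. *)
Lemma ldp_bounds_of_between T l : approximating T ->
  (forall h, negative_part T h -> Lambda_exists le mu t h) ->
  finite_cover_condition le mu t ->
  (forall x, X0 R X x -> l x <= l0 le mu t x) ->
  (forall x, l_out le mu t T x <= l x) -> ldp_bounds le mu t l.
Proof.
move=> aT exT fcc ll0 lTl; split.
- move=> x; apply: (le_trans (l0_ge0 x)); apply: le_trans (lTl x).
  exact: l_out_ge_l0.
- move=> F cF; apply: (le_trans (ldp_upper_bound fcc cF)).
  apply/ereal_supP => _ [[x [Fx X0x] <-]|->]; last first.
    by apply: ereal_sup_ubound; right.
  apply: (@le_trans _ _ (expeR (- l x))); first by rewrite lee_expeR leeN2 ll0.
  by apply: ereal_sup_ubound; left; exists x.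
- move=> G oG; have G0 : 0 <= net_liminf le (mu_pow mu t G).
    by apply: net_liminf_ge0 => // a; exact: mu_pow_ge0.
  apply/ereal_supP => _ [[x Gx <-]|->//].
  rewrite expeR_le_lne// leeNl; apply: le_trans (lTl x).
  exact: l_out_ge_liminf.
Qed.

(** * Lower regularizations *)

Lemma is_lower_regularization_id l : lower_semicontinuous l ->
  is_lower_regularization l l.
Proof. by split => // J _; exact. Qed.

(** Points off [A] carry the value [+oo] and do not affect infima over neighbourhoods. *)
Lemma is_lower_regularization_on (A : set X) l :
  lower_semicontinuous l ->
  is_lower_regularization (fun x => if x \in A then l x else +oo)
    (fun x => ereal_sup [set ereal_inf [set l y | y in G `&` A]
                        | G in [set G : set X | open G /\ G x]]).
Proof.
move=> lsc; split.
- move=> x a /ereal_sup_gt[_ [G [oG Gx] <-] aG].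
  exists G; first exact: open_nbhs_nbhs.
  move=> y Gy; apply: (lt_le_trans aG); apply: ereal_sup_ubound.
  by exists G.
- move=> x; apply/ereal_supP => _ [G [oG Gx] <-]; case: ifPn => [/set_mem Ax|_].
    by apply: ereal_inf_lbound; exists x.
  by rewrite leey.
- move=> J lscJ Jl x; apply: lee_of_lt_fin => a aJ.
  (* The neighbourhood is the strict superlevel set of the competitor [J], open by semicontinuity;
     on its trace on [A], [l] is at least [a]. *)
  apply: le_ereal_sup_tmp; eexists.
    exists [set y | a%:E < J y] => //; split => //.
    by move/lower_semicontinuousP: lscJ; exact.
  apply/ereal_infP => _ [y [aJy Ay] <-]; apply: (le_trans (ltW aJy)).
  by have := Jl y; rewrite mem_set.
Qed.

(** * Truncated functions and their limit *)

Lemma Lambda_inf_truncation_le h (M N : R) : continuous h -> (M <= N)%R ->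
  Lambda_inf le mu t (truncation h M) <= Lambda_inf le mu t (truncation h N).
Proof.
move=> ch MN; apply: le_lne.
  by apply: net_liminf_ge0 => // a; exact: exp_pow_ge0.
apply: le_net_liminf => // a; apply: le_exp_pow => //.
- exact: truncation_borel.
- exact: truncation_borel.
move=> y; rewrite /truncation; case: ifPn => [hM|_]; last by rewrite leNye.
by rewrite (lt_le_trans hM)// lee_fin.
Qed.

Lemma Lambda_inf_truncation_le_sup h (M : R) : continuous h ->
  Lambda_inf le mu t (truncation h M) <= Lambda_sup le mu t h.
Proof.
move=> ch; apply: le_lne.
  by apply: net_liminf_ge0 => // a; exact: exp_pow_ge0.
apply: le_trans (net_liminf_le_limsup le_directed _).
apply: le_net_liminf => // a; apply: le_exp_pow => //.
- exact: truncation_borel.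
- exact: continuous_borel.
by move=> y; rewrite /truncation; case: ifPn => // _; rewrite leNye.
Qed.

Lemma cvg_opp_Lambda_inf_truncation h : continuous h ->
  - Lambda_inf le mu t (truncation h M) @[M --> +oo%R] -->
  ereal_inf (range (fun M => - Lambda_inf le mu t (truncation h M))).
Proof.
move=> ch; apply: nonincreasing_cvge => M N MN.
by rewrite leeN2; exact: Lambda_inf_truncation_le.
Qed.

(** By monotonicity the limit is an infimum over [M], so one well-chosen [M] suffices. Near [x] that
    truncation agrees with [h], and the Chebyshev bound is used with liminf in place of limsup. *)
Lemma lim_truncation_le T h x (r : R) : approximating T ->
  (forall h, negative_part T h -> Lambda_exists le mu t h) ->
  T h -> (- r)%:E <= h x ->
  lim (- Lambda_inf le mu t (truncation h M) @[M --> +oo%R]) <=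
  r%:E + l_out le mu t T x.
Proof.
move=> aT exT Th rh; have [/(_ h Th)[ch hoo] _] := aT.
rewrite (cvg_lim (@ereal_hausdorff _) (cvg_opp_Lambda_inf_truncation ch)).
apply/lee_addgt0Pr => e e0.
(* Members of an approximating class never take the value [+oo]. *)
have [M hM] : exists M : R, h x < M%:E.
  case: (h x) (hoo x) => [z _|//|_].
    by exists (z + 1)%R; rewrite lte_fin ltrDl.
  by exists 0%R; rewrite ltNyr.
apply: (@le_trans _ _ (- Lambda_inf le mu t (truncation h M))).
  by apply: ereal_inf_lbound; exists M.
pose G := h @^-1` ([set y | (- (r + e))%:E < y] `&` [set y | y < M%:E]).
have oG : open G.
  apply: open_comp => [y _|]; first exact: ch.
  by apply: openI; [exact: open_ereal_gt_ereal|exact: open_ereal_lt_ereal].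
have Gx : G x.
  by split => //; apply: lt_le_trans rh; rewrite lte_fin ltrN2 ltrDl.
have hG y : G y -> (- (r + e))%:E <= truncation h M y.
  by move=> [ry yM]; rewrite /truncation ifT// ltW.
have G0 : 0 <= net_liminf le (mu_pow mu t G).
  by apply: net_liminf_ge0 => // a; exact: mu_pow_ge0.
have E0 : 0 <= net_liminf le (exp_pow mu t (truncation h M)).
  by apply: net_liminf_ge0 => // a; exact: exp_pow_ge0.
have qL : (- (r + e))%:E + lne (net_liminf le (mu_pow mu t G)) <=
    Lambda_inf le mu t (truncation h M).
  apply: lne_ge_add => //; apply: net_liminfZ_le; first exact: expR_gt0.
  move=> a; apply: exp_pow_ge => //; first exact: truncation_borel.
  exact: open_borel.
rewrite addeAC -EFinD.
apply: (@le_trans _ _ ((r + e)%:E - lne (net_liminf le (mu_pow mu t G)))).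
  by rewrite leeNl addeC fin_num_oppeD// oppeK addeC -EFinN.
by rewrite leeD2l//; exact: l_out_ge_liminf.
Qed.

End RateFunction.

Theorem proposition2 (R : realType) (X : ptopologicalType)
    (X_not_point : exists x y : X, x <> y)
    (compact_borel : forall K : set X, compact K ->
       measurable (K : set (borel X)))
    (I : Type) (le : I -> I -> Prop) (le_directed : directed le)
    (mu : I -> probability (borel X) R) (t : I -> R)
    (t_gt0 : forall a, (0 < t a)%R)
    (t_cvg0 : t @ tails le --> (0 : R)%R) :
  ((X0_exponentially_tight le mu t -> finite_cover_condition le mu t) /\
   (exponentially_tight le mu t /\
      (forall x, ~ X0 R X x -> l0 le mu t x = +oo) ->
    finite_cover_condition le mu t) /\
   ((forall K : set X, compact K -> closed K) ->
    X0_exponentially_tight le mu t ->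
    exponentially_tight le mu t /\
      (forall x, ~ X0 R X x -> l0 le mu t x = +oo))) /\
  (forall T : set (X -> \bar R), approximating T ->
   finite_cover_condition le mu t ->
   (forall h, negative_part T h -> Lambda_exists le mu t h) ->
   [/\ ldp_rate_function le mu t (l_class le mu t T),
       forall x, l_class le mu t T x = l_class le mu t (negative_part T) x,
       forall x, X0 R X x ->
         l_class le mu t T x =
         ereal_inf [set ereal_sup [set - Lambda le mu t h | h in
             [set h | negative_part T h /\ (- r)%:E <= h x]]
           | r in [set r : R | (0 < r)%R]],
       (forall h, T h ->
          cvg (- Lambda_inf le mu t (truncation h M) @[M --> +oo%R])) /\
       (forall x, X0 R X x ->
         l_class le mu t T x =
         ereal_inf [set ereal_sup [set
               lim (- Lambda_inf le mu t (truncation h M) @[M --> +oo%R]) | h in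
             [set h | T h /\ (- r)%:E <= h x]]
           | r in [set r : R | (0 < r)%R]]) &
       (forall J1 J2 : X -> \bar R,
          ldp_rate_function le mu t J1 -> ldp_rate_function le mu t J2 ->
          forall x, J1 x = J2 x) ->
       forall x, l_class le mu t T x =
         ereal_sup [set ereal_inf [set l_class le mu t T y | y in G `&` X0 R X]
           | G in [set G : set X | open G /\ G x]]]).
Proof.
split.
  split; [move=> tight|split; [move=> [tight l0oo]|move=> cK_closed tight]].
  - apply: finite_cover_condition_of_compact => // e /tight[K [cK KX0 Ke]].
    by exists K; split => // x /KX0.
  - apply: finite_cover_condition_of_compact => // e /tight[K [cK Ke]].
    by exists K; split => // x _; exact: l0oo.
  - split; last exact: X0_tight_l0_infty.
    by move=> e /tight[K [cK _ Ke]]; exists K.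
move=> T aT fcc exT; have [cT aT'] := aT.
have aT_ := approximating_negative_part aT.
have lT : l_class le mu t T = l_out le mu t T.
  by apply/funext => x; exact: l_class_l_out.
have lsc : lower_semicontinuous (l_class le mu t T).
  by rewrite lT; exact: lower_semicontinuous_l_out.
have rateT : ldp_rate_function le mu t (l_class le mu t T).
  exists (l_class le mu t T); last exact: is_lower_regularization_id.
  apply: (ldp_bounds_of_between le_directed t_gt0 t_cvg0 aT exT fcc) => x.
    by move=> X0x; rewrite l_class_l0.
  by rewrite lT.
split => //.
- by move=> x; rewrite !l_class_l_out//; exact: l_out_negative_part.
- move=> x X0x; rewrite l_class_l0//; symmetry; apply: inf_sup_eq_l0 => //.
    move=> h r r0 Th hx; have [-> _] := Lambda_existsE le_directed (exT h Th).
    by apply: opp_Lambda_sup_le => //; have [] := cT h Th.1.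
  move=> G s r oG Gx s0 r0; have [h Th hb] := aT_.2 x G s r X0x oG Gx s0 r0.
  exists h; split => //; first exact: bump_ge hb.
  have [-> _] := Lambda_existsE le_directed (exT h Th).
  by apply: opp_Lambda_sup_ge => //; [have [] := cT h Th.1|exact: hb.2].
- split=> [h Th|x X0x].
    apply/cvg_ex; eexists; apply: cvg_opp_Lambda_inf_truncation => //.
    by have [] := cT h Th.
  rewrite l_class_l0//; symmetry; apply: inf_sup_eq_l0 => //.
    move=> h r r0 Th hx.
    (* The truncation estimate is stated with [l_out], which coincides with [l0] on [X0] through
       [l_class]. *)
    rewrite -(@l_class_l0 _ _ _ _ le_directed mu t t_gt0 t_cvg0 T)//.
    by rewrite lT; exact: lim_truncation_le.
  move=> G s r oG Gx s0 r0; have [h Th hb] := aT' x G s r X0x oG Gx s0 r0.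
  have [ch _] := cT h Th; exists h; split => //; first exact: bump_ge hb.
  rewrite (cvg_lim (@ereal_hausdorff _)
    (cvg_opp_Lambda_inf_truncation le_directed t_gt0 ch)).
  apply/ereal_infP => _ [M _ <-].
  (* Every truncation lies below [h], so the bump bound for [h] itself holds uniformly in [M]. *)
  apply: (@le_trans _ _ (- Lambda_sup le mu t h)).
    by apply: opp_Lambda_sup_ge => //; exact: hb.2.
  by rewrite leeN2; exact: Lambda_inf_truncation_le_sup.
move=> uniq.
suff rateJ : ldp_rate_function le mu t (fun x => ereal_sup [set ereal_inf
    [set l_class le mu t T y | y in G `&` X0 R X]
    | G in [set G : set X | open G /\ G x]]) by exact: (uniq _ _ rateT rateJ).
(* This function satisfies the same bounds, and its lower regularization is the displayed formula;
   uniqueness then identifies the two rate functions. *)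
exists (fun x => if x \in X0 R X then l_class le mu t T x else +oo).
  apply: (ldp_bounds_of_between le_directed t_gt0 t_cvg0 aT exT fcc) => y.
    by move=> X0y; rewrite mem_set// l_class_l0.
  by case: ifPn => _; rewrite ?leey// lT.
exact: is_lower_regularization_on.
Qed.
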